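(* Let $k\ge 1$. If there exists a (randomized) online algorithm for the Hydra game on the $k$-factorial tree whose total (expected) cost is at most $R$ against every adversary, then there exists a (randomized) $(R+1)$-competitive online algorithm for the generalized $k$-server problem in uniform metrics.
   Context: Hydra game: played between an online algorithm and an oblivious adversary on a fixed rooted unweighted tree $T$ known in advance. Each node is asleep, alive, or dead; initially the root is alive and all others asleep. In each step the adversary picks an alive node, makes it dead and makes all its children alive. The algorithm must always be at an alive node (initially the root); if its node is killed it moves to an alive node, paying the shortest-path distance in $T$. The game ends when all nodes but one are dead; the cost is the total movement. The $k$-factorial tree is the rooted tree of height $k$ (root at level $k$, leaves at level $0$) in which every node at level $d$ has exactly $d$ children. Generalized $k$-server problem in uniform metrics: given uniform metric spaces $M_1,\dots,M_k$, where $M_i$ has $n_i\ge 2$ points at pairwise distance $1$, server $s_i$ starts at a fixed point of $M_i$ and always stays in $M_i$. Requests arrive online as $k$-tuples $(r_1,\dots,r_k)\in\prod_i M_i$; to serve a request an algorithm moves servers so that $s_i$ is at $r_i$ for at least one $i$, before seeing the next request. The cost is the total distance traveled by all servers. A randomized online algorithm $\mathrm{ALG}$ is $\beta$-competitive if there is a constant $\gamma$ (possibly depending on $k$ and the metrics but not on the request sequence) such that for every input $I$, $\mathbf{E}[\mathrm{ALG}(I)]\le \beta\cdot \mathrm{OPT}(I)+\gamma$, where $\mathrm{OPT}(I)$ is the optimal offline cost. *)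

(* Defs.v *)
From HB Require Import structures.
From mathcomp Require Import all_boot all_order all_algebra.
From mathcomp Require Import reals.
Set Implicit Arguments. Unset Strict Implicit. Unset Printing Implicit Defensive.
Import Order.TTheory GRing.Theory Num.Theory.
Local Open Scope ring_scope.

(* A node is identified with its path from the root: the list of child       *)
(* indices.  The root is [::] (level k).  A node s at level d = k - size s   *)
(* has exactly d children, namely rcons s i for i < d.                       *)
Fixpoint fnodes (d : nat) : seq (seq nat) :=
  match d with
  | 0 => [:: [::]]
  | d'.+1 => [::] :: [seq i :: s | i <- iota 0 d, s <- fnodes d']
  end.

Definition tparent (s : seq nat) : seq nat := take (size s).-1 s.

(* longest common prefix = path to the lowest common ancestor *)
Fixpoint lcp (s t : seq nat) : seq nat :=
  match s, t with
  | x :: s', y :: t' => if x == y then x :: lcp s' t' else [::]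
  | _, _ => [::]
  end.

(* Shortest-path distance in the (unweighted) tree:
   depth u + depth v - 2 depth (lca u v). *)
Definition tdist (s t : seq nat) : nat := (size s + size t - 2 * size (lcp s t))%N.

Section Hydra.
Variables (R : realType) (k : nat).

(* After the adversary killed the nodes in [ks] (in order), node s is alive   *)
(* iff it is a node of the tree, is not dead, and is the root or its parent   *)
(* is dead (its parent's death woke it up).  Other non-dead nodes are asleep. *)
Definition halive (ks : seq (seq nat)) (s : seq nat) : bool :=
  [&& s \in fnodes k, s \notin ks & (s == [::]) || (tparent s \in ks)].

Definition valid_kills (ks : seq (seq nat)) : Prop :=
  forall j, (j < size ks)%N -> halive (take j ks) (nth [::] ks j).

(* an adversary = a complete game: it plays until all nodes but one are dead *)
Definition hydra_adversary (adv : seq (seq nat)) : Prop :=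
  valid_kills adv /\ size adv = (size (fnodes k)).-1.

(* A randomized online Hydra algorithm (behavioural form): when its node is  *)
(* killed, given the sequence of kills so far [ks] (including the current    *)
(* one) and its own history of positions [ps] (last = the killed node), it   *)
(* outputs a probability distribution on nodes, supported on alive nodes.    *)
Definition hydra_alg := seq (seq nat) -> seq (seq nat) -> seq nat -> R.

Definition valid_hydra_alg (HA : hydra_alg) : Prop :=
  forall ks ps, valid_kills ks -> (size ks < size (fnodes k))%N ->
    [/\ forall u, 0 <= HA ks ps u,
        \sum_(u <- fnodes k) HA ks ps u = 1
      & forall u, 0 < HA ks ps u -> halive ks u].

(* expected remaining movement cost; [ks] past kills, [ps] past positions     *)
(* (last = current position p), [adv] remaining kills of the adversary.      *)
Fixpoint hydra_cost (HA : hydra_alg) (ks ps : seq (seq nat)) (p : seq nat)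
    (adv : seq (seq nat)) : R :=
  match adv with
  | [::] => 0
  | v :: adv' =>
      let ks' := rcons ks v in
      if v == p then
        \sum_(u <- fnodes k)
           HA ks' ps u * ((tdist p u)%:R + hydra_cost HA ks' (rcons ps u) u adv')
      else hydra_cost HA ks' ps p adv'
  end.

Definition hydra_total_cost (HA : hydra_alg) (adv : seq (seq nat)) : R :=
  hydra_cost HA [::] [:: [::]] [::] adv.

End Hydra.

Section GenKServer.
Variables (R : realType) (k : nat) (n : 'I_k -> nat).

(* M_i is the uniform metric on 'I_(n i); configurations and requests are   *)
(* elements of prod_i M_i.                                                    *)
Definition kconf : finType := {dffun forall i : 'I_k, 'I_(n i)}.

Definition cdist (c c' : kconf) : nat := #|[pred i | c i != c' i]|.

Definition covers (c r : kconf) : bool := [exists i, c i == r i].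

(* Randomized online algorithm (behavioural form): given the requests so far *)
(* (the last one is the current request) and its own past configurations     *)
(* (the last one is the current configuration), it outputs a probability     *)
(* distribution over the next configuration, supported on configurations     *)
(* serving the current request.                                             *)
Definition kserver_alg := seq kconf -> seq kconf -> kconf -> R.

Definition valid_kserver_alg (A : kserver_alg) : Prop :=
  forall rs r cs,
    [/\ forall c, 0 <= A (rcons rs r) cs c,
        \sum_(c : kconf) A (rcons rs r) cs c = 1
      & forall c, 0 < A (rcons rs r) cs c -> covers c r].

Fixpoint kserver_cost (A : kserver_alg) (rsp cs : seq kconf) (c : kconf)
    (rs : seq kconf) : R :=
  match rs with
  | [::] => 0
  | r :: rs' =>
      let rsp' := rcons rsp r in
      \sum_(c' : kconf)
         A rsp' cs c' * ((cdist c c')%:R + kserver_cost A rsp' (rcons cs c') c' rs')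
  end.

Definition ALG (A : kserver_alg) (c0 : kconf) (rs : seq kconf) : R :=
  kserver_cost A [::] [:: c0] c0 rs.

Definition offline_cost (c0 : kconf) (s : seq kconf) : nat :=
  sumn (pairmap cdist c0 s).

(* OPT: minimum offline cost over all feasible configuration sequences.      *)
(* The neutral element k * size rs is an upper bound on the cost of any      *)
(* feasible sequence (each step moves at most k servers by 1), so for k >= 1 *)
(* (when feasible sequences exist) it does not affect the minimum.          *)
Definition OPT (c0 : kconf) (rs : seq kconf) : nat :=
  \big[minn/(k * size rs)%N]_(s : (size rs).-tuple kconf | all2 covers s rs)
     offline_cost c0 s.

Definition competitive (A : kserver_alg) (c0 : kconf) (beta : R) : Prop :=
  exists gamma : R, forall rs, ALG A c0 rs <= beta * (OPT c0 rs)%:R + gamma.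

End GenKServer.

(* Main.v *)
Require Import Defs.
From HB Require Import structures.
From mathcomp Require Import all_boot all_order all_algebra.
From mathcomp Require Import reals.
Set Implicit Arguments. Unset Strict Implicit. Unset Printing Implicit Defensive.
Import Order.TTheory GRing.Theory Num.Theory.
Local Open Scope ring_scope.

(** Split the requests into phases.  Within a phase, a node at level [d] of the
    [k]-factorial tree stands for the set of configurations in which [d] servers
    are free and the others sit at prescribed points.  A request that misses all
    the prescribed points of an alive node kills it, and its [d] children
    prescribe the request's point for one more server, so that the alive nodes
    cover exactly the configurations serving the whole phase.  The online
    algorithm keeps its servers consistent with the node of a simulated Hydra
    player; going up in the tree is free and going down one edge moves at most
    one server, so a phase costs at most [rho].  When no node remains alive, one
    server is moved (this is the [+ 1]) and a new phase starts; no single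
    configuration serves all the requests of a finished phase, so the optimum
    pays at least [1] for it. *)

(** * The factorial tree and sequences of kills *)

Lemma mem_fnodes_nil d : [::] \in fnodes d.
Proof. by case: d. Qed.

Lemma fnodesS d :
  fnodes d.+1 = [::] :: [seq i :: s | i <- iota 0 d.+1, s <- fnodes d].
Proof. by []. Qed.

Lemma mem_fnodes_cons d i s :
  (i :: s \in fnodes d) = (i < d)%N && (s \in fnodes d.-1).
Proof.
case: d => [|d]; first by rewrite inE.
rewrite fnodesS inE [d.+1.-1]/=; apply/allpairsP/andP.
  by case=> -[j t]; rewrite mem_iota => -[ltjd td [-> ->]].
by case=> ltid sd; exists (i, s); rewrite mem_iota.
Qed.

Lemma fnodes_uniq d : uniq (fnodes d).
Proof.
elim: d => // d IHd; rewrite fnodesS cons_uniq; apply/andP; split.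
  by apply/negP=> /allpairsP[[j t] []].
by apply: allpairs_uniq => [||[? ?] [? ?] _ _ /= [-> ->]] //; apply: iota_uniq.
Qed.

Lemma fnodes_take d j s : s \in fnodes d -> take j s \in fnodes d.
Proof.
elim: s d j => [|i s IHs] d [|j] //=; rewrite ?mem_fnodes_nil //.
by rewrite !mem_fnodes_cons => /andP[-> /IHs->].
Qed.

Lemma lcp_prefixl s t : exists s', s = lcp s t ++ s'.
Proof.
elim: s t => [|x s IHs] [|y t] /=;
  [by exists [::]|by exists [::]|by exists (x :: s)|].
by case: eqP => [_|_]; [case: (IHs t) => s' {1}->; exists s'|exists (x :: s)].
Qed.

Lemma lcp_prefixr s t : exists t', t = lcp s t ++ t'.
Proof.
elim: s t => [|x s IHs] [|y t] /=;
  [by exists [::]|by exists (y :: t)|by exists [::]|].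
by case: eqP => [->|_]; [case: (IHs t) => t' {1}->; exists t'|exists (y :: t)].
Qed.

Section Kills.
Variable k : nat.
Implicit Types (ks kl : seq (seq nat)) (u v : seq nat).

Lemma valid_kills_rcons ks v :
  valid_kills k (rcons ks v) <-> valid_kills k ks /\ halive k ks v.
Proof.
split=> [val|[val av] j].
  split=> [j ltj|]; last first.
    have := val (size ks); rewrite size_rcons nth_rcons ltnn eqxx.
    by rewrite -cats1 take_size_cat //; apply.
  have := val j; rewrite size_rcons nth_rcons ltj -cats1 take_cat ltj.
  by apply; apply: ltnW.
rewrite size_rcons ltnS leq_eqVlt => /orP[/eqP->|ltj].
  by rewrite nth_rcons ltnn eqxx -cats1 take_size_cat.
by rewrite nth_rcons ltj -cats1 take_cat ltj; apply: val.
Qed.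

Lemma valid_kills_cat ks kl : valid_kills k (ks ++ kl) -> valid_kills k ks.
Proof.
elim/last_ind: kl => [|kl v IHkl]; first by rewrite cats0.
by rewrite -rcons_cat => /valid_kills_rcons[/IHkl].
Qed.

Lemma valid_kills_uniq ks : valid_kills k ks -> uniq ks.
Proof.
elim/last_ind: ks => // ks v IHks /valid_kills_rcons[/IHks uks /and3P[_ vNks _]].
by rewrite rcons_uniq vNks.
Qed.

Lemma valid_kills_fnodes ks : valid_kills k ks -> {subset ks <= fnodes k}.
Proof.
elim/last_ind: ks => // ks v IHks /valid_kills_rcons[/IHks sub /and3P[vk _ _]] u.
by rewrite mem_rcons inE => /predU1P[->|/sub].
Qed.

Lemma valid_kills_parent ks v :
  valid_kills k ks -> v \in ks -> (v == [::]) || (tparent v \in ks).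
Proof.
elim/last_ind: ks => // ks u IHks /valid_kills_rcons[/IHks par /and3P[_ _ pu]].
rewrite !mem_rcons !inE => /predU1P[->|/par]; last first.
  by case: eqP => //= _ ->; rewrite orbT.
by case: eqP pu => //= _ ->; rewrite orbT.
Qed.

(** A node dies only after its parent, so deadness climbs to every proper ancestor. The hypothesis
    on [v] holds for alive and for dead nodes, which lets the induction pass to the parent. *)
Lemma dead_take ks v j : valid_kills k ks ->
  (v == [::]) || (tparent v \in ks) -> (j < size v)%N -> take j v \in ks.
Proof.
move=> val; elim/last_ind: v => // v i IHv.
have -> : (rcons v i == [::]) = false by case: v {IHv}.
rewrite /tparent size_rcons /= -cats1 take_size_cat // => vks.
rewrite ltnS leq_eqVlt => /predU1P[->|ltj]; first by rewrite take_size_cat.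
rewrite take_cat ltj; apply: IHv => //; exact: valid_kills_parent.
Qed.

Lemma alive_take ks v j : valid_kills k ks -> halive k ks v ->
  (j < size v)%N -> take j v \in ks.
Proof. by move=> val /and3P[_ _]; apply: dead_take. Qed.

Lemma halive_cat ks kl v :
  halive k ks v -> v \notin kl -> halive k (ks ++ kl) v.
Proof.
case/and3P=> vk vNks par vNkl; rewrite /halive vk !mem_cat negb_or vNks vNkl /=.
by case: eqP par => //= _ ->.
Qed.

(** Killing one alive node leaves the other ones alive, so the nodes missed by a single request may
    be killed one after the other in any order. *)
Lemma valid_kills_catalive ks kl : valid_kills k ks -> uniq kl ->
  {in kl, forall v, halive k ks v} -> valid_kills k (ks ++ kl).
Proof.
move=> val; elim/last_ind: kl => [|kl v IHkl]; first by rewrite cats0.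
rewrite rcons_uniq => /andP[vNkl ukl] alkl.
rewrite -rcons_cat; apply/valid_kills_rcons; split.
  by apply: IHkl => // u ukl'; apply: alkl; rewrite mem_rcons inE ukl' orbT.
by apply: halive_cat => //; apply: alkl; rewrite mem_rcons inE eqxx.
Qed.

Lemma size_kills_alive ks u :
  valid_kills k ks -> halive k ks u -> (size ks < size (fnodes k))%N.
Proof.
move=> val /and3P[uk uNks _].
apply: (@uniq_leq_size _ (u :: ks)); first by rewrite /= uNks valid_kills_uniq.
by move=> v; rewrite inE => /predU1P[->//|]; apply: valid_kills_fnodes.
Qed.

(** From a node that is not dead, climb as long as the parent is not dead: the climb stops at the
    root or below a dead parent, hence at an alive node. *)
Lemma exists_alive ks : (size ks < size (fnodes k))%N -> exists u, halive k ks u.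
Proof.
move=> ltks.
have /allPn[u uk uNks] : ~~ all (mem ks) (fnodes k).
  apply: contraL ltks => /allP sub; rewrite -leqNgt.
  by apply: uniq_leq_size => //; apply: fnodes_uniq.
elim/last_ind: u uk uNks => [|u i IHu] uk uNks.
  by exists [::]; rewrite /halive uk uNks.
have tu : take (size u) (rcons u i) = u by rewrite -cats1 take_size_cat.
have uk' : u \in fnodes k by rewrite -tu fnodes_take.
have [uks|/(IHu uk')//] := boolP (u \in ks).
by exists (rcons u i); rewrite /halive uk uNks /tparent size_rcons tu uks orbT.
Qed.

Lemma extend_kills ks : valid_kills k ks -> (size ks < size (fnodes k))%N ->
  exists kl, hydra_adversary k (ks ++ kl).
Proof.
move=> + ltks; have [m leqm] : exists m, (size ks + m = (size (fnodes k)).-1)%N.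
  exists ((size (fnodes k)).-1 - size ks)%N.
  by case: (size (fnodes k)) ltks => // N ltN; rewrite /= subnKC.
elim: m ks leqm {ltks} => [|m IHm] ks szks val.
  by exists [::]; rewrite cats0; split=> //; rewrite -szks addn0.
have [|u au] := @exists_alive ks.
  case: (size (fnodes k)) szks => [|N /= <-]; first by rewrite addnS.
  by rewrite ltnS leq_addr.
have [||kl hkl] := IHm (rcons ks u); first by rewrite size_rcons addSnnS.
  exact/valid_kills_rcons.
by exists (u :: kl); rewrite -cat_rcons.
Qed.

End Kills.

(** * Cost of the Hydra player on incomplete games *)

Section HydraCost.
Variables (R : realType) (k : nat) (HA : hydra_alg R).
Hypothesis HAvalid : valid_hydra_alg k HA.

Lemma hydra_cost_ge0 ks ps p adv : valid_kills k (ks ++ adv) ->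
  (size (ks ++ adv) < size (fnodes k))%N -> 0 <= hydra_cost k HA ks ps p adv.
Proof.
elim: adv ks ps p => //= v adv IHadv ks ps p; rewrite -cat_rcons => val lt.
case: ifP => _; last exact: IHadv.
have [|HA0 _ _] := HAvalid ps (valid_kills_cat val).
  by apply: leq_ltn_trans lt; rewrite size_cat leq_addr.
by apply: sumr_ge0 => u _; rewrite mulr_ge0 // addr_ge0 ?IHadv.
Qed.

Lemma hydra_cost_cat ks ps p adv adv' : valid_kills k (ks ++ adv ++ adv') ->
  (size (ks ++ adv ++ adv') < size (fnodes k))%N ->
  hydra_cost k HA ks ps p adv <= hydra_cost k HA ks ps p (adv ++ adv').
Proof.
elim: adv ks ps p => [|v adv IHadv] ks ps p.
  exact: hydra_cost_ge0.
rewrite cat_cons /= -cat_rcons => val lt.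
case: ifP => _; last exact: IHadv.
have [|HA0 _ _] := HAvalid ps (valid_kills_cat val).
  by apply: leq_ltn_trans lt; rewrite size_cat leq_addr.
by apply: ler_sum => u _; rewrite ler_wpM2l // lerD2l IHadv.
Qed.

(** The bound is assumed for complete games only; a partial game is completed, and the extra kills
    add a nonnegative cost. *)
Lemma hydra_total_cost_prefix rho kl :
  (forall adv, hydra_adversary k adv -> hydra_total_cost k HA adv <= rho) ->
  valid_kills k kl -> (size kl < size (fnodes k))%N ->
  hydra_total_cost k HA kl <= rho.
Proof.
move=> HArho val lt; have [adv' hadv] := extend_kills val lt.
apply: le_trans (HArho _ hadv); have [val' sz'] := hadv.
apply: hydra_cost_cat => //=; rewrite sz'.
by case: (size (fnodes k)) lt.
Qed.

End HydraCost.
(** * Configurations attached to the nodes of the tree *)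

Section Constraints.
Variables (k : nat) (n : 'I_k -> nat) (x0 : 'I_k).
Local Notation kc := (kconf n).
Implicit Types (c r : kc) (L : seq ('I_k * kc)) (K : seq nat -> kc).
Implicit Types (l : seq 'I_k) (u v : seq nat).

Lemma cdist_triangle c1 c2 c3 : (cdist c1 c3 <= cdist c1 c2 + cdist c2 c3)%N.
Proof.
rewrite /cdist -cardUI; apply: leq_trans (leq_addr _ _).
apply/subset_leq_card/subsetP=> i; rewrite !inE.
by case: (eqVneq (c1 i) (c2 i)) => [->|].
Qed.

Lemma cdistnn c : cdist c c = 0%N.
Proof. by apply: eq_card0 => i; rewrite !inE eqxx. Qed.

Lemma cdist_eq0 c c' : cdist c c' = 0%N -> c = c'.
Proof.
by move=> /card0_eq eqcc'; apply/ffunP=> i; have /negbFE/eqP := eqcc' i.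
Qed.

Definition setc c (x : 'I_k) r : kc :=
  [ffun i : 'I_k => if i == x then r i else c i].

Lemma cdist_setc c c' x r :
  (cdist c (setc c' x r) <= cdist c c' + (c x != r x))%N.
Proof.
have -> : (c x != r x) = #|[pred i | (i == x) && (c x != r x)]| :> nat.
  case: (c x != r x); last by apply/esym/eq_card0 => i; rewrite !inE andbF.
  by rewrite -[LHS](card1 x); apply: eq_card => i; rewrite !inE ?andbT.
rewrite /cdist -cardUI; apply: leq_trans (leq_addr _ _).
apply/subset_leq_card/subsetP=> i; rewrite !inE ffunE.
by case: (eqVneq i x) => [->|_] -> //=; rewrite orbT.
Qed.

Lemma covers_setc c x r : covers (setc c x r) r.
Proof. by apply/existsP; exists x; rewrite ffunE eqxx. Qed.

Definition agree c (q : 'I_k * kc) := c q.1 == q.2 q.1.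

Definition consistent c L := all (agree c) L.

Definition move_to c L : kc := foldr (fun q c' => setc c' q.1 q.2) c L.

Lemma move_to_consistent c L : uniq (unzip1 L) -> consistent (move_to c L) L.
Proof.
elim: L => //= q L IHL /andP[qNL /IHL cL].
rewrite /consistent /= {1}/agree ffunE !eqxx /=.
apply/allP=> p pL; have := allP cL p pL; rewrite /agree ffunE.
by case: (eqVneq p.1 q.1) => // p1; rewrite -p1 map_f in qNL.
Qed.

Lemma cdist_move_to c L :
  (cdist c (move_to c L) <= count (predC (agree c)) L)%N.
Proof.
elim: L => [|q L IHL] /=; first by rewrite cdistnn.
by apply: leq_trans (cdist_setc _ _ _ _) _; rewrite addnC leq_add2l.
Qed.

(* Entry [j] names the server fixed at the [j]-th edge on the path to [u] and the
   request prescribing its position; [l] lists the servers that are still free. *)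
Fixpoint constraints K l u : seq ('I_k * kc) :=
  if u is i :: u' then
    let x := nth x0 l i in
    (x, K [::]) :: constraints (fun w => K (i :: w)) (rem x l) u'
  else [::].

Lemma size_constraints K l u : size (constraints K l u) = size u.
Proof. by elim: u K l => //= i u IHu K l; rewrite IHu. Qed.

Lemma constraints_cat K l u v :
  exists L, constraints K l (u ++ v) = constraints K l u ++ L.
Proof.
elim: u K l => [|i u IHu] K l; first by exists (constraints K l v).
by have [L /= ->] := IHu (fun w => K (i :: w)) (rem (nth x0 l i) l); exists L.
Qed.

Lemma constraints_rcons K l u i : exists x, constraints K l (rcons u i) =
  rcons (constraints K l u) (x, K u).
Proof.
elim: u K l => [|j u IHu] K l; first by exists (nth x0 l i).
by have [x /= ->] := IHu (fun w => K (j :: w)) (rem (nth x0 l j) l); exists x.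
Qed.

(** The prescriptions of [u] consult [K] only at proper prefixes of [u]. *)
Lemma eq_constraints K K' l u :
  (forall j, (j < size u)%N -> K (take j u) = K' (take j u)) ->
  constraints K l u = constraints K' l u.
Proof.
elim: u K K' l => //= i u IHu K K' l eqK; congr (_ :: _).
  by have /= -> := eqK 0%N isT.
by apply: IHu => j ltj; apply: (eqK j.+1).
Qed.

(** Each edge has an index below the number of servers still free, so [nth] never falls back on
    [x0], and the server it picks is removed for the rest of the path. *)
Lemma constraints_uniq K l u d : uniq l -> size l = d -> u \in fnodes d ->
  uniq (unzip1 (constraints K l u)) /\ {subset unzip1 (constraints K l u) <= l}.
Proof.
elim: u K l d => [|i u IHu] K l d ul szl //.
rewrite mem_fnodes_cons => /andP[ltid ud] /=.
have xl : nth x0 l i \in l by rewrite mem_nth ?szl.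
have [||//|uu sub] := IHu (fun w => K (i :: w)) (rem (nth x0 l i) l) d.-1.
- exact: rem_uniq.
- by rewrite size_rem ?szl.
split; last by move=> y; rewrite inE => /predU1P[->//|/sub/mem_rem].
rewrite uu andbT; apply/negP=> /sub; by rewrite mem_rem_uniq // inE eqxx.
Qed.

(** A node at level [m] has [m] children, one for each of its [m] free servers; this dictates the
    factorial shape of the tree. *)
Lemma exists_child K l u d y : uniq l -> size l = d -> u \in fnodes d ->
  y \in l -> y \notin unzip1 (constraints K l u) ->
  exists2 i, rcons u i \in fnodes d &
    constraints K l (rcons u i) = rcons (constraints K l u) (y, K u).
Proof.
elim: u K l d => [|i u IHu] K l d ul szl /=.
  move=> _ yl _; exists (index y l); last by rewrite nth_index.
  by rewrite mem_fnodes_cons mem_fnodes_nil -szl index_mem yl.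
rewrite mem_fnodes_cons => /andP[ltid ud] yl.
rewrite inE negb_or => /andP[yNx yNu].
have [||//|||j uj eqj] := IHu (fun w => K (i :: w)) (rem (nth x0 l i) l) d.-1.
- exact: rem_uniq.
- by rewrite size_rem ?mem_nth ?szl.
- by rewrite mem_rem_uniq // inE yNx.
- by [].
by exists j; rewrite ?mem_fnodes_cons ?ltid // eqj.
Qed.

Definition node_constraints K u := constraints K (enum 'I_k) u.

Definition hit K r u := has (agree r) (node_constraints K u).

Lemma hit_covers K r u c : consistent c (node_constraints K u) -> hit K r u ->
  covers c r.
Proof.
move=> /allP cu /hasP[q qu /eqP rq]; apply/existsP; exists q.1.
by rewrite rq; apply: cu.
Qed.

Lemma node_constraints_uniq K u : u \in fnodes k ->
  uniq (unzip1 (node_constraints K u)).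
Proof.
by case/(constraints_uniq K (enum_uniq 'I_k)); first by rewrite size_enum_ord.
Qed.

Lemma consistent_move_node K c u : u \in fnodes k ->
  consistent (move_to c (node_constraints K u)) (node_constraints K u).
Proof. by move=> uk; apply/move_to_consistent/node_constraints_uniq. Qed.

(* The constraints attached to the common ancestor already hold, so only the
   way down from it to the new node is paid for. *)
Lemma cdist_move_node K c u v : consistent c (node_constraints K u) ->
  (cdist c (move_to c (node_constraints K v)) <= tdist u v)%N.
Proof.
move=> cu; apply: leq_trans (cdist_move_to _ _) _.
have [u' eu] := lcp_prefixl u v; have [v' ev] := lcp_prefixr u v.
have [Lu eLu] := constraints_cat K (enum 'I_k) (lcp u v) u'.
have [Lv eLv] := constraints_cat K (enum 'I_k) (lcp u v) v'.
rewrite -eu in eLu; rewrite -ev in eLv.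
move: cu; rewrite /node_constraints eLu eLv.
rewrite /consistent all_cat => /andP[cw _].
have -> : count (predC (agree c))
    (constraints K (enum 'I_k) (lcp u v) ++ Lv) =
    count (predC (agree c)) Lv.
  rewrite count_cat; apply/eqP; rewrite -{2}[count _ Lv]add0n eqn_add2r.
  rewrite -leqn0 leqNgt -has_count; apply/hasPn => q /(allP cw).
  by move=> /= ->.
apply: leq_trans (count_size _ _) _.
have /(congr1 size) := eLv; have /(congr1 size) := eLu.
rewrite !size_cat !size_constraints /tdist => -> ->.
by rewrite mulSn mul1n addnACA addKn leq_addl.
Qed.

End Constraints.
(** * Removing the internal randomness of an online algorithm *)

Section Realization.
Variables (R : realType) (k : nat) (n : 'I_k -> nat) (D : Type) (S : eqType).
Local Notation kc := (kconf n).
Variables (dstep : D -> kc -> D) (step : D -> kc -> S -> seq (R * S)).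
Variables (conf : S -> kc) (Inv : D -> S -> Prop) (D0 : D) (s0 : S).
Hypothesis k_gt0 : (0 < k)%N.
Hypothesis Inv0 : Inv D0 s0.
Hypothesis step_sum : forall d r s, Inv d s -> \sum_(y <- step d r s) y.1 = 1.
Hypothesis stepP : forall d r s y, Inv d s -> y \in step d r s ->
  [/\ 0 <= y.1, Inv (dstep d r) y.2 & covers (conf y.2) r].

(** The component [d] is determined by the requests alone; only [s] is random, with the weighted
    list [step d r s] as its transition law. *)
Fixpoint internal_cost d s (rs : seq kc) : R :=
  if rs is r :: rs' then
    \sum_(y <- step d r s) y.1 * ((cdist (conf s) (conf y.2))%:R +
                                  internal_cost (dstep d r) y.2 rs')
  else 0.

Definition law_step (dl : D * seq (R * S)) r :=
  (dstep dl.1 r, [seq (x.1 * y.1, y.2) | x <- dl.2, y <- step dl.1 r x.2]).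

Definition law rs := foldl law_step (D0, [:: (1, s0)]) rs.

Lemma law_rcons rs r : law (rcons rs r) = law_step (law rs) r.
Proof. exact: foldl_rcons. Qed.

Lemma lawP rs x : x \in (law rs).2 -> 0 <= x.1 /\ Inv (law rs).1 x.2.
Proof.
elim/last_ind: rs x => [|rs r IHrs] x; first by rewrite inE => /eqP->.
rewrite law_rcons => /allpairsPdep[y [z [/IHrs[y0 yI] /(stepP yI)[z0 zI _] ->]]].
by rewrite mulr_ge0.
Qed.

Definition mass rs c := \sum_(x <- (law rs).2 | conf x.2 == c) x.1.

Definition joint_mass rs r c c' := \sum_(x <- (law rs).2 | conf x.2 == c)
  x.1 * \sum_(y <- step (law rs).1 r x.2 | conf y.2 == c') y.1.

(* Only the joint law of two consecutive configurations matters for the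
   expected cost, so the internal state may be replaced by its conditional law
   given the current configuration. *)
Definition realize : kserver_alg R n := fun hist cs c' =>
  let rs := take (size hist).-1 hist in
  let r := last (conf s0) hist in
  let c := last (conf s0) cs in
  if mass rs c == 0 then (c' == r)%:R else joint_mass rs r c c' / mass rs c.

Lemma realize_rcons rs r cs c' : realize (rcons rs r) cs c' =
  if mass rs (last (conf s0) cs) == 0 then (c' == r)%:R
  else joint_mass rs r (last (conf s0) cs) c' / mass rs (last (conf s0) cs).
Proof. by rewrite /realize last_rcons size_rcons -cats1 take_size_cat. Qed.

Lemma mass_ge0 rs c : 0 <= mass rs c.
Proof. by rewrite /mass big_seq_cond sumr_ge0 // => x /andP[/lawP[]]. Qed.

Lemma joint_mass_ge0 rs r c c' : 0 <= joint_mass rs r c c'.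
Proof.
rewrite /joint_mass big_seq_cond sumr_ge0 // => x /andP[/lawP[x0 xI] _].
by rewrite mulr_ge0 // big_seq_cond sumr_ge0 // => y /andP[/(stepP xI)[]].
Qed.

Lemma sum_fibers (T : Type) (I : finType) (l : seq T) (g : T -> I)
    (F : T -> I -> R) :
  \sum_(i : I) \sum_(x <- l | g x == i) F x i = \sum_(x <- l) F x (g x).
Proof.
under eq_bigr do rewrite big_mkcond.
rewrite exchange_big; apply: eq_bigr => x _.
by rewrite -big_mkcond (big_pred1 (g x)) // => i; rewrite /= eq_sym.
Qed.

Lemma sum_joint_mass_conf rs r c : \sum_c' joint_mass rs r c c' = mass rs c.
Proof.
rewrite /joint_mass exchange_big /mass big_seq_cond [RHS]big_seq_cond.
apply: eq_bigr => x /andP[/lawP[_ xI] _].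
by rewrite -mulr_sumr sum_fibers step_sum // mulr1.
Qed.

Lemma sum_joint_mass rs r (f : kc -> kc -> R) :
  \sum_c \sum_c' joint_mass rs r c c' * f c c' = \sum_(x <- (law rs).2)
    x.1 * \sum_(y <- step (law rs).1 r x.2) y.1 * f (conf x.2) (conf y.2).
Proof.
rewrite -(sum_fibers _ (fun x => conf x.2) (fun x c =>
  x.1 * \sum_(y <- step (law rs).1 r x.2) y.1 * f c (conf y.2))).
apply: eq_bigr => c _.
under eq_bigr do rewrite mulr_suml.
rewrite exchange_big; apply: eq_bigr => x _.
rewrite -(sum_fibers _ (fun y => conf y.2) (fun y c' => y.1 * f c c')).
rewrite mulr_sumr; apply: eq_bigr => c' _.
by rewrite -mulrA mulr_suml.
Qed.

Lemma sum_joint_mass_prev rs r c' :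
  \sum_c joint_mass rs r c c' = mass (rcons rs r) c'.
Proof.
rewrite /joint_mass (sum_fibers _ (fun x => conf x.2) (fun x c => x.1 *
  \sum_(y <- step (law rs).1 r x.2 | conf y.2 == c') y.1)).
rewrite /mass law_rcons /= [RHS]big_mkcond big_allpairs_dep; apply: eq_bigr => x _ /=.
by rewrite big_mkcond mulr_sumr; apply: eq_bigr => y _; case: eqP; rewrite ?mulr0.
Qed.

(** The product form also covers a configuration of probability zero: nonnegative joint masses of
    sum zero all vanish. *)
Lemma mass_realize rs r cs c' :
  mass rs (last (conf s0) cs) * realize (rcons rs r) cs c' =
  joint_mass rs r (last (conf s0) cs) c'.
Proof.
rewrite realize_rcons; case: eqVneq => [m0|mN0]; last by rewrite mulrC divfK.
have : \sum_c'' joint_mass rs r (last (conf s0) cs) c'' == 0.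
  by rewrite sum_joint_mass_conf m0.
rewrite psumr_eq0 => [/allP/(_ c')|c'' _]; last exact: joint_mass_ge0.
by rewrite mem_index_enum m0 mul0r => /(_ isT)/eqP.
Qed.

Lemma realize_valid : valid_kserver_alg realize.
Proof.
move=> rs r cs; split=> [c||c].
- rewrite realize_rcons; case: ifP => _; first exact: ler0n.
  by rewrite divr_ge0 ?mass_ge0 ?joint_mass_ge0.
- under eq_bigr do rewrite realize_rcons.
  case: eqVneq => [_|mN0]; last by rewrite -mulr_suml sum_joint_mass_conf divff.
  by rewrite (bigD1 r) //= eqxx big1 ?addr0 // => c /negPf->.
rewrite realize_rcons; case: eqVneq => [_|mN0].
  case: eqVneq => [-> _|_]; last by rewrite ltxx.
  (* A configuration of probability zero is sent to [r] itself, which serves [r] because there is at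
     least one server. *)
  by apply/existsP; exists (Ordinal k_gt0).
apply: contraTT => cNr; rewrite /joint_mass big_seq_cond big1 ?mul0r ?ltxx //.
move=> x /andP[/lawP[_ xI] _]; rewrite big_seq_cond big1 ?mulr0 // => y.
by case/andP=> /(stepP xI)[_ _ cov] /eqP ycE; rewrite -ycE cov in cNr.
Qed.

(** [realize] reads only the last configuration of its history, so older ones can be forgotten and
    an induction on the requests can restart from a one-element history. *)
Lemma realize_cost_last hist cs c rs : last (conf s0) cs = c ->
  kserver_cost realize hist cs c rs = kserver_cost realize hist [:: c] c rs.
Proof.
elim: rs hist cs c => //= r rs IHrs hist cs c cE; apply: eq_bigr => c' _.
rewrite !realize_rcons cE /= (IHrs _ (rcons cs c')) ?last_rcons //.
by rewrite (IHrs _ [:: c; c']).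
Qed.

Lemma realize_cost hist rs :
  \sum_c mass hist c * kserver_cost realize hist [:: c] c rs =
  \sum_(x <- (law hist).2) x.1 * internal_cost (law hist).1 x.2 rs.
Proof.
elim: rs hist => [|r rs IHrs] hist /=.
  by rewrite !big1 // => *; rewrite mulr0.
transitivity (\sum_c \sum_c' joint_mass hist r c c' * ((cdist c c')%:R +
    kserver_cost realize (rcons hist r) [:: c'] c' rs)).
  apply: eq_bigr => c _; rewrite mulr_sumr; apply: eq_bigr => c' _.
  by rewrite mulrA (mass_realize _ _ [:: c]) (@realize_cost_last _ [:: c; c']).
(* The movement depends on both configurations, the remaining cost only on the new one. Summing out
   the old one in the second part gives the law after [r], to which the induction hypothesis
   applies. *)
under [LHS]eq_bigr do under eq_bigr do rewrite mulrDr.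
under [LHS]eq_bigr do rewrite big_split.
rewrite big_split /= sum_joint_mass [X in _ + X = _]exchange_big /=.
under [X in _ + X = _]eq_bigr do rewrite -mulr_suml sum_joint_mass_prev.
rewrite IHrs law_rcons /= big_allpairs_dep -big_split; apply: eq_bigr => x _ /=.
under [in RHS]eq_bigr do rewrite mulrDr.
rewrite big_split /= mulrDr; congr (_ + _).
by rewrite mulr_sumr; apply: eq_bigr => y _; rewrite mulrA.
Qed.

Lemma exists_realization :
  exists2 A : kserver_alg R n, valid_kserver_alg A &
    forall rs, ALG A (conf s0) rs = internal_cost D0 s0 rs.
Proof.
exists realize => [|rs]; first exact: realize_valid.
have := realize_cost [::] rs; rewrite /law /= big_seq1 mul1r => <-.
rewrite /ALG (bigD1 (conf s0)) //= big1 ?addr0 => [|c cN].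
  by rewrite /mass big_mkcond big_seq1 eqxx mul1r.
by rewrite /mass big_mkcond big_seq1 eq_sym (negPf cN) mul0r.
Qed.

End Realization.
(** * The phase-based algorithm *)

Section Reduction.
Variables (R : realType) (k : nat) (hk : (0 < k)%N) (n : 'I_k -> nat).
Local Notation kc := (kconf n).
Variables (HA : hydra_alg R) (rho : R) (c0 : kc).
Hypothesis HAvalid : valid_hydra_alg k HA.
Hypothesis HArho :
  forall adv, hydra_adversary k adv -> hydra_total_cost k HA adv <= rho.

Let x0 : 'I_k := Ordinal hk.

(* The nodes killed in the current phase, and for each of them the request
   that killed it (junk on the other nodes). *)
Notation phase := (seq (seq nat) * (seq nat -> kc))%type.
Implicit Types (d : phase) (c r : kc) (rs : seq kc) (u v : seq nat).
Implicit Types (ks kl ps : seq (seq nat)).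

Definition killed d r :=
  [seq v <- fnodes k | halive k d.1 v & ~~ hit x0 d.2 r v].

Definition after d r : phase :=
  (d.1 ++ killed d r, fun v => if v \in killed d r then r else d.2 v).

Definition phase_ends d r := ~~ has (halive k (after d r).1) (fnodes k).

Definition fresh : phase := ([::], fun=> c0).

(** The request that ends a phase belongs to the finished phase; the next one starts with an
    untouched tree. *)
Definition next_phase d r := if phase_ends d r then fresh else after d r.

Definition phase_inv d :=
  valid_kills k d.1 /\ (size d.1 < size (fnodes k))%N.

Lemma halive_fresh : halive k fresh.1 [::].
Proof. by rewrite /halive mem_fnodes_nil. Qed.

Lemma after_valid d r : valid_kills k d.1 -> valid_kills k (after d r).1.
Proof.
move=> val; apply: valid_kills_catalive => //.
  by rewrite filter_uniq ?fnodes_uniq.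
by move=> v; rewrite mem_filter => /andP[/andP[]].
Qed.

Lemma fresh_inv : phase_inv fresh.
Proof. by split=> //; apply: size_kills_alive halive_fresh. Qed.

Lemma after_inv d r : phase_inv d -> ~~ phase_ends d r -> phase_inv (after d r).
Proof.
case=> val _; rewrite negbK => /hasP[u _ au]; have val' := @after_valid d r val.
by split=> //; apply: size_kills_alive au.
Qed.

Lemma next_phase_inv d r : phase_inv d -> phase_inv (next_phase d r).
Proof.
move=> dI; rewrite /next_phase; case: ifPn => [_|]; first exact: fresh_inv.
exact: after_inv.
Qed.

(** The proper ancestors of an alive node died at earlier requests, so recording the new kills
    leaves its prescriptions intact. *)
Lemma constraints_after d r u : valid_kills k d.1 -> halive k d.1 u ->
  node_constraints x0 (after d r).2 u = node_constraints x0 d.2 u.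
Proof.
move=> val au; apply: eq_constraints => j /(alive_take val au) uks /=.
by rewrite mem_filter /halive uks andbF.
Qed.

(** A node alive both before and after [r] was spared because [r] hits it; a node just woken has a
    parent killed by [r], and its last prescription comes from [r]. Hence one round of kills per
    request suffices. *)
Lemma after_hit d r u : valid_kills k d.1 -> halive k (after d r).1 u ->
  hit x0 (after d r).2 r u.
Proof.
move=> val /and3P[uk]; rewrite mem_cat negb_or => /andP[uNks uNkl].
have [par _|] := boolP ((u == [::]) || (tparent u \in d.1)).
  have au : halive k d.1 u by rewrite /halive uk uNks.
  rewrite /hit constraints_after //; move: uNkl.
  by rewrite mem_filter au uk andbT negbK.
rewrite negb_or => /andP[]; case/lastP: u uk {uNks uNkl} => // u i uk.
rewrite /tparent size_rcons -cats1 take_size_cat //= cats1 => _ uNks.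
rewrite mem_cat (negPf uNks) /= => /orP[/eqP/(congr1 size)|ukl].
  by rewrite size_rcons.
have [x xE] := constraints_rcons x0 (after d r).2 (enum 'I_k) u i.
by rewrite /hit /node_constraints xE has_rcons /agree /= ukl eqxx.
Qed.

(** * Comparison of the number of finished phases with the offline optimum *)

Definition survives d c := has
  (fun u => halive k d.1 u && consistent c (node_constraints x0 d.2 u)) (fnodes k).

Lemma survivesP d c : reflect
  (exists2 u, halive k d.1 u & consistent c (node_constraints x0 d.2 u))
  (survives d c).
Proof.
apply: (iffP hasP) => [[u _ /andP[]]|[u au cu]]; first by exists u.
by exists u; rewrite ?au //; case/and3P: au.
Qed.

Lemma survives_fresh c : survives fresh c.
Proof. by apply/survivesP; exists [::] => //; apply: halive_fresh. Qed.

(** If the node holding [c] is killed, the server with which [c] covers [r] is still free there, and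
    the child fixing that server at its point of [r] is alive and consistent with [c]. *)
Lemma survives_after d c r : valid_kills k d.1 -> survives d c -> covers c r ->
  survives (after d r) c.
Proof.
move=> val /survivesP[u au cu] /existsP[i /eqP ciE]; apply/survivesP.
have uk : u \in fnodes k by case/and3P: au.
have [ukl|uNkl] := boolP (u \in killed d r); last first.
  by exists u; [apply: halive_cat|rewrite constraints_after].
(* Were server [i] already fixed at [u], its prescribed point would be [c i = r i], so [r] would hit
   [u]. *)
have iNu : i \notin unzip1 (node_constraints x0 (after d r).2 u).
  rewrite constraints_after //; apply/negP=> /mapP[q qu iE].
  move: ukl; rewrite mem_filter => /andP[/andP[_ /hasPn/(_ q qu)]].
  by have := allP cu q qu; rewrite /agree -iE ciE => ->.
have [||j ujk ujE] := exists_child (enum_uniq 'I_k) _ uk _ iNu.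
- by rewrite size_enum_ord.
- by rewrite mem_enum.
exists (rcons u j); last first.
  rewrite /node_constraints ujE /consistent all_rcons.
  apply/andP; split; first by rewrite /agree /= ukl ciE eqxx.
  by rewrite -/(node_constraints x0 _ u) constraints_after.
have tuj : tparent (rcons u j) = u.
  by rewrite /tparent size_rcons -cats1 take_size_cat.
(* Before [r] the child is asleep below the alive node [u], so it is neither dead already nor among
   the nodes killed by [r]. *)
have ujN : rcons u j \notin d.1.
  apply/negP=> /(valid_kills_parent val); rewrite tuj.
  case: eqP => [/(congr1 size)|_ /=]; first by rewrite size_rcons.
  by case/and3P: au => _ /negPf->.
rewrite /halive ujk tuj !mem_cat ukl !orbT andbT negb_or ujN.
rewrite mem_filter /halive tuj ujN ujk /=.
case: eqP => [/(congr1 size)|_ /=]; first by rewrite size_rcons.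
by case/and3P: au => _ /negPf->.
Qed.

Fixpoint phases_ended d rs : nat :=
  if rs is r :: rs' then (phase_ends d r + phases_ended (next_phase d r) rs')%N
  else 0%N.

Lemma phases_ended_size d rs : (phases_ended d rs <= size rs)%N.
Proof. by elim: rs d => //= r rs IHrs d; rewrite -add1n leq_add ?leq_b1. Qed.

(** Potential argument: the boolean term stands for a unit already paid by an offline player whose
    configuration has dropped out of the current phase. *)
Lemma phases_ended_offline d c rs s : phase_inv d -> all2 (@covers k n) s rs ->
  (phases_ended d rs <= offline_cost c s + ~~ survives d c)%N.
Proof.
rewrite /offline_cost; elim: rs s d c => [|r rs IHrs] [|c1 s] d c dI //=.
case/andP=> cov /(IHrs _ _ c1 (next_phase_inv r dI)) {}IHrs.
(* The potential grows only when the offline player moves: staying at a surviving configuration that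
   covers [r] keeps it surviving. *)
have surv : (~~ survives (after d r) c1 <= cdist c c1 + ~~ survives d c)%N.
  case: (posnP (cdist c c1)) => [/cdist_eq0 ->|cc1].
    rewrite cdistnn; case: (boolP (survives d c1)) => [sc1|_]; last exact: leq_b1.
    by rewrite survives_after //; case: dI.
  by apply: leq_trans (leq_addr _ _); apply: leq_trans cc1; apply: leq_b1.
rewrite [leqRHS]addnAC; move: IHrs; rewrite /next_phase.
have [ends|_] := boolP (phase_ends d r); last first.
  rewrite add0n => /leq_trans; apply; rewrite addnC; exact: leq_add.
(* No node is alive at a phase end, so [c1] does not survive [r] and by [surv] a unit is available
   to pay for the phase; the fresh phase starts with potential 0. *)
rewrite survives_fresh addn0; apply: leq_add; apply: leq_trans surv.
rewrite lt0b; apply/survivesP=> -[u au _]; case/hasP: ends.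
by exists u => //; case/and3P: au.
Qed.

Lemma phases_ended_OPT rs : (phases_ended fresh rs <= OPT c0 rs)%N.
Proof.
rewrite /OPT; elim/big_rec: _ => [|s m cov mE].
  (* The default value of the minimum also dominates: at most one phase ends per request, and [k] is
     positive. *)
  by apply: leq_trans (phases_ended_size _ _) _; rewrite leq_pmull.
rewrite leq_min mE andbT.
by rewrite -[leqRHS]addn0 -[0%N]/(~~ true : nat) -(survives_fresh c0)
  phases_ended_offline //; apply: fresh_inv.
Qed.

(* The successive moves of the Hydra player while the nodes [kl] are killed,
   as a finitely supported law on pairs (positions, configuration). *)
Fixpoint simulate (K : seq nat -> kc) ks ps c kl :
    seq (R * (seq (seq nat) * kc)) :=
  if kl is v :: kl' then
    let ks' := rcons ks v in
    if v == last [::] ps then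
      [seq (HA ks' ps u * y.1, y.2) | u <- [seq u <- fnodes k | halive k ks' u],
         y <- simulate K ks' (rcons ps u)
                (move_to c (node_constraints x0 K u)) kl']
    else simulate K ks' ps c kl'
  else [:: (1, (ps, c))].

(** [simulate] lists alive targets only, so that each outcome, even one of weight zero, satisfies
    the invariant; the omitted targets have probability zero. *)
Lemma sum_alive ks ps (F : seq nat -> R) :
  valid_kills k ks -> (size ks < size (fnodes k))%N ->
  \sum_(u <- fnodes k) HA ks ps u * F u =
  \sum_(u <- fnodes k | halive k ks u) HA ks ps u * F u.
Proof.
move=> val lt; have [HA0 _ HAal] := HAvalid ps val lt.
rewrite [RHS]big_mkcond; apply: eq_bigr => u _; case: ifPn => // uNal.
have : ~~ (0 < HA ks ps u) by apply: contra uNal => /HAal.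
by rewrite lt_def HA0 andbT negbK => /eqP->; rewrite mul0r.
Qed.

Section Simulate.
Variable K : seq nat -> kc.

Definition sim_inv ks (s : seq (seq nat) * kc) :=
  halive k ks (last [::] s.1) &&
  consistent s.2 (node_constraints x0 K (last [::] s.1)).

Lemma sim_inv_move ks ps u c : halive k ks u ->
  sim_inv ks (rcons ps u, move_to c (node_constraints x0 K u)).
Proof.
move=> au; rewrite /sim_inv last_rcons au consistent_move_node //.
by case/and3P: au.
Qed.

Lemma sim_inv_stay ks v s :
  sim_inv ks s -> v != last [::] s.1 -> sim_inv (rcons ks v) s.
Proof.
case/andP=> al cs vN; rewrite /sim_inv cs -cats1 halive_cat //.
by rewrite inE eq_sym.
Qed.

Lemma simulateP ks ps c kl y :
  valid_kills k (ks ++ kl) -> (size (ks ++ kl) < size (fnodes k))%N ->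
  sim_inv ks (ps, c) -> y \in simulate K ks ps c kl ->
  0 <= y.1 /\ sim_inv (ks ++ kl) y.2.
Proof.
elim: kl ks ps c y => [|v kl IHkl] ks ps c y /=.
  by rewrite cats0 => _ _ sI; rewrite inE => /eqP->.
rewrite -cat_rcons => val lt sI; have val' := valid_kills_cat val.
case: eqVneq => [vE|vN]; last by apply: IHkl => //; apply: sim_inv_stay.
case/allpairsPdep=> [u [z [ul zu ->]]].
move: ul; rewrite mem_filter => /andP[au _].
have [z0 zI] := IHkl _ _ _ _ val lt (sim_inv_move _ _ au) zu.
have [|HA0 _ _] := HAvalid ps val'.
  by apply: leq_ltn_trans lt; rewrite size_cat leq_addr.
by rewrite mulr_ge0.
Qed.

Lemma sum_simulate ks ps c kl :
  valid_kills k (ks ++ kl) -> (size (ks ++ kl) < size (fnodes k))%N ->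
  \sum_(y <- simulate K ks ps c kl) y.1 = 1.
Proof.
elim: kl ks ps c => [|v kl IHkl] ks ps c /=; first by rewrite big_seq1.
rewrite -cat_rcons => val lt; case: ifP => _; last exact: IHkl.
have val' := valid_kills_cat val.
have lt' : (size (rcons ks v) < size (fnodes k))%N.
  by apply: leq_ltn_trans lt; rewrite size_cat leq_addr.
rewrite big_allpairs_dep big_filter.
have [_ <- _] := HAvalid ps val' lt'.
under [RHS]eq_bigr do rewrite -[HA _ _ _]mulr1.
rewrite sum_alive //; apply: eq_bigr => u _.
by rewrite -mulr_sumr IHkl.
Qed.

(** By the triangle inequality the direct move from [c] to the final configuration costs at most the
    moves it shortcuts, each bounded by a tree distance. The suffix [fut] carries the later Hydra
    cost, so that bounds for successive requests chain. *)
Lemma simulate_cost ks ps c kl fut :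
  valid_kills k (ks ++ kl) -> (size (ks ++ kl) < size (fnodes k))%N ->
  sim_inv ks (ps, c) ->
  \sum_(y <- simulate K ks ps c kl) y.1 * ((cdist c y.2.2)%:R +
     hydra_cost k HA (ks ++ kl) y.2.1 (last [::] y.2.1) fut)
  <= hydra_cost k HA ks ps (last [::] ps) (kl ++ fut).
Proof.
elim: kl ks ps c => [|v kl IHkl] ks ps c /=.
  by move=> _ _ _; rewrite big_seq1 /= cats0 cdistnn add0r mul1r.
rewrite -cat_rcons => val lt sI.
case: eqVneq => [vE|vN]; last by apply: IHkl => //; apply: sim_inv_stay.
have val' := valid_kills_cat val.
have lt' : (size (rcons ks v) < size (fnodes k))%N.
  by apply: leq_ltn_trans lt; rewrite size_cat leq_addr.
have [HA0 _ _] := HAvalid ps val' lt'.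
rewrite sum_alive // big_allpairs_dep big_filter; apply: ler_sum => u au /=.
under eq_bigr do rewrite -mulrA.
rewrite -mulr_sumr ler_wpM2l //.
set cu := move_to c _; have sI' : sim_inv (rcons ks v) (rcons ps u, cu).
  exact: sim_inv_move.
have := IHkl _ _ _ val lt sI'; rewrite last_rcons => IHu.
have cu_le : (cdist c cu)%:R <= (tdist (last [::] ps) u)%:R :> R.
  by rewrite ler_nat; apply: cdist_move_node; case/andP: sI.
apply: le_trans (lerD cu_le IHu).
(* The weights of the outcomes sum to 1, so the cost of the first move is spread over them and the
   comparison is made outcome by outcome. *)
rewrite -[X in _ <= X + _]mul1r.
rewrite -[X in _ <= X * _ + _](sum_simulate (rcons ps u) cu val lt).
rewrite mulr_suml -big_split /= big_seq [leRHS]big_seq.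
apply: ler_sum => y yl; have [y0 _] := simulateP val lt sI' yl.
rewrite -mulrDr ler_wpM2l // addrA lerD2r -natrD ler_nat.
exact: cdist_triangle.
Qed.

End Simulate.

(** The root prescribes nothing, so any configuration may open a phase; moving the single server
    [x0] serves the closing request at cost at most 1. *)
Definition server_step d r (s : seq (seq nat) * kc) :
    seq (R * (seq (seq nat) * kc)) :=
  if phase_ends d r then [:: (1, ([:: [::]], setc s.2 x0 r))]
  else simulate (after d r).2 d.1 s.1 s.2 (killed d r).

Definition state_inv d s := phase_inv d /\ sim_inv d.2 d.1 s.

Lemma state_inv_after d r s :
  valid_kills k d.1 -> sim_inv d.2 d.1 s -> sim_inv (after d r).2 d.1 s.
Proof. by move=> val /andP[al cs]; rewrite /sim_inv al constraints_after. Qed.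

Lemma fresh_state_inv c : state_inv fresh ([:: [::]], c).
Proof. by split; [apply: fresh_inv|rewrite /sim_inv /= halive_fresh]. Qed.

Lemma server_step_sum d r s : state_inv d s ->
  \sum_(y <- server_step d r s) y.1 = 1.
Proof.
case=> dI sI; rewrite /server_step; case: ifPn => [_|]; first by rewrite big_seq1.
by case/(after_inv dI) => val lt; apply: sum_simulate.
Qed.

Lemma server_stepP d r s y : state_inv d s -> y \in server_step d r s ->
  [/\ 0 <= y.1, state_inv (next_phase d r) y.2 & covers y.2.2 r].
Proof.
case=> dI sI; rewrite /server_step /next_phase; case: ifPn => [_|nends].
  by rewrite inE => /eqP->; split=> //; [apply: fresh_state_inv|apply: covers_setc].
have dI' := after_inv dI nends; have [val' lt'] := dI'; have [val _] := dI.
have sI' : sim_inv (after d r).2 d.1 (s.1, s.2) by apply: state_inv_after.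
case/(simulateP val' lt' sI')=> y0 yI; split=> //.
case/andP: yI => al cs; apply: hit_covers cs _; exact: after_hit.
Qed.

(** * Accounting of the expected cost over the phases *)

Local Notation server_cost :=
  (internal_cost next_phase server_step (fun s => s.2)).

(** The oblivious Hydra adversary induced by the requests. It stops before the request that ends the
    phase, whose kills would leave the player no alive node. *)
Fixpoint future_kills d rs :=
  if rs is r :: rs' then
    if phase_ends d r then [::] else killed d r ++ future_kills (after d r) rs'
  else [::].

Lemma future_kills_inv d rs : phase_inv d ->
  valid_kills k (d.1 ++ future_kills d rs) /\
  (size (d.1 ++ future_kills d rs) < size (fnodes k))%N.
Proof.
elim: rs d => [|r rs IHrs] d dI /=; first by rewrite cats0.
case: ifPn => [_|nends]; first by rewrite cats0.
by rewrite catA; apply: (IHrs (after d r)); apply: after_inv.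
Qed.

Lemma future_cost_fresh rs : hydra_total_cost k HA (future_kills fresh rs) <= rho.
Proof.
have [val lt] := future_kills_inv rs fresh_inv.
exact: hydra_total_cost_prefix.
Qed.

(** Each phase end is charged one unit for the server move and [rho] for the Hydra game of the
    following phase; the Hydra term is what remains to be paid in the current game. *)
Lemma server_cost_le d s rs : state_inv d s ->
  server_cost d s rs <=
  hydra_cost k HA d.1 s.1 (last [::] s.1) (future_kills d rs) +
  (rho + 1) * (phases_ended d rs)%:R.
Proof.
elim: rs d s => [|r rs IHrs] d s sI /=; first by rewrite mulr0 addr0.
have [dI ssI] := sI; have stP y := @server_stepP d r s y sI.
move: stP; rewrite [server_step d r s]/server_step [next_phase d r]/next_phase.
case: ifPn => [_ _|nends stP].
  have move1 : (cdist s.2 (setc s.2 x0 r))%:R <= 1 :> R.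
    rewrite (ler_nat R _ 1); apply: leq_trans (cdist_setc _ _ _ _) _.
    by rewrite cdistnn leq_b1.
  have sF := IHrs _ _ (fresh_state_inv (setc s.2 x0 r)).
  have fF := lerD (future_cost_fresh rs) (lexx _).
  rewrite big_seq1 mul1r; apply: le_trans (lerD move1 (le_trans sF (fF _))) _.
  by rewrite add0r (natrD _ 1) mulrDr mulr1 addrA [1 + rho]addrC.
have [val' lt'] := after_inv dI nends; have [val _] := dI.
have sI' : sim_inv (after d r).2 d.1 (s.1, s.2) by apply: state_inv_after.
have simc := simulate_cost (future_kills (after d r) rs) val' lt' sI'.
rewrite add0n; apply: le_trans (lerD simc (lexx _)).
(* The number of later phase ends does not depend on the outcome, so its term is spread over the
   outcomes in the same way. *)
rewrite -[X in _ <= _ + X]mul1r.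
rewrite -[X in _ <= _ + X * _](sum_simulate (after d r).2 s.1 s.2 val' lt').
rewrite mulr_suml -big_split /= big_seq [leRHS]big_seq.
apply: ler_sum => y yl; have [y0 yI _] := stP _ yl.
by rewrite -mulrDr ler_wpM2l // -addrA lerD2l IHrs.
Qed.

End Reduction.

Theorem theorem6 (R : realType) (k : nat) (hk : (1 <= k)%N) (rho : R) :
  (exists HA : hydra_alg R,
      valid_hydra_alg k HA /\
      forall adv, hydra_adversary k adv -> hydra_total_cost k HA adv <= rho) ->
  forall (n : 'I_k -> nat), (forall i, (2 <= n i)%N) ->
  forall c0 : kconf n,
    exists A : kserver_alg R n,
      valid_kserver_alg A /\ competitive A c0 (rho + 1).
Proof.
case=> HA [HAvalid HArho] n _ c0.
have [A Aval Acost] := exists_realization (conf := fun s => s.2) hk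
  (fresh_state_inv hk c0 c0)
  (fun d r s => @server_step_sum _ _ _ _ _ HAvalid d r s)
  (fun d r s y => @server_stepP _ _ _ _ _ c0 HAvalid d r s y).
(* The additive constant [rho] covers the first phase, whose Hydra game is charged to no phase
   end. *)
exists A; split=> //; exists rho => rs.
rewrite (Acost rs) addrC.
apply: le_trans (server_cost_le c0 HAvalid HArho rs (fresh_state_inv hk c0 c0)) _.
(* The empty request sequence yields an empty game of cost 0; the sign of [rho] allows the number of
   phases to be replaced by [OPT]. *)
have rho_ge0 : 0 <= rho by exact: (future_cost_fresh hk c0 HAvalid HArho [::]).
apply: lerD; first exact: (future_cost_fresh hk c0 HAvalid HArho).
by rewrite ler_wpM2l ?addr_ge0 // ler_nat phases_ended_OPT.
Qed.
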